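(* Consider the flexible multi-facility capacity expansion problem described in the context, with risk-neutral optimal value $$\mathrm{ENPV}_{\mathrm{flex}}=\max_{\mathcal K_{[T]}\in\bar{\mathcal K}}\ \mathbb E\left[-Q(\mathcal K_{[T]},\xi)\right]$$ and, for $\alpha\in(0,1)$ and $\beta\in[0,1]$, risk-averse (mean-CVaR) optimal value $$\mathrm{ENPV}_\alpha(\beta)=\max_{u\in\mathbb R,\ \mathcal K_{[T]}\in\bar{\mathcal K}}\ -(1-\beta)u-\mathbb E\left[\beta Q(\mathcal K_{[T]},\xi)+\frac{1-\beta}{1-\alpha}\left[Q(\mathcal K_{[T]},\xi)-u\right]_+\right].$$ Then: (i) For every $\alpha\in(0,1)$, the function $\beta\mapsto \mathrm{ENPV}_\alpha(\beta)$ is non-decreasing on $[0,1]$. (ii) $\mathrm{ENPV}_{\mathrm{flex}}\ge \mathrm{ENPV}_\alpha(\beta)$ for all $\beta\in[0,1]$ and $\alpha\in(0,1)$.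
   Context: Sets: facilities $\mathcal N=\{1,\dots,N\}$, customers $\mathcal I=\{1,\dots,I\}$, periods $\mathcal T=\{1,\dots,T\}$, line segments $\mathcal L=\{1,\dots,L\}$. Capacity levels: $\mathbb K=\{K\in\mathbb Z_+^N: K\le K^{\max}\}$ for a given vector $K^{\max}$. Demand: $\Xi_t\subset\mathbb R^I$ is the (nonnegative) demand sample space at time $t=0,\dots,T$; $\Xi=\times_{t=0}^T\Xi_t$; $\xi=(\xi_0,\dots,\xi_T)$ is a random element of $\Xi$ with $\xi_t=(\xi_{1t},\dots,\xi_{It})\ge 0$ integrable and $\xi_0$ known (deterministic); $\xi_{[t]}=(\xi_0,\dots,\xi_t)$. Policies: a policy is $\mathcal K_{[T]}=(\mathcal K_0,\dots,\mathcal K_T)$ with each $\mathcal K_t:\Xi_0\times\cdots\times\Xi_t\to\mathbb K$ (measurable; non-anticipative because it depends only on $\xi_{[t]}$). The feasible set is $$\bar{\mathcal K}=\{(\mathcal K_0,\dots,\mathcal K_T): \mathcal K_{t-1}(\xi_{[t-1]})\le\mathcal K_t(\xi_{[t]})\ \ \forall t\in\mathcal T,\ \xi\in\Xi\}.$$ Profit: for real constants $r_{int}$, $b_{it}$, $$\Pi_t(K_{t-1},\xi_t)=\max_{z\ge 0}\Big\{\sum_{i,n} r_{int}z_{int}-\sum_{i} b_{it}\big(\xi_{it}-\sum_n z_{int}\big): \sum_n z_{int}\le\xi_{it}\ \forall i,\ \ \sum_i z_{int}\le K_{n(t-1)}\ \forall n\Big\}.$$ Expansion cost: for each $n$, breakpoints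 $0=a_{n1}<a_{n2}<\dots<a_{n(L+1)}$ with $K_n^{\max}<a_{n(L+1)}$, and real slopes $p_{nlt}$ and intercepts $q_{nlt}$; $c_t(\Delta K)=\sum_{n\in\mathcal N} c_{nt}(\Delta K_n)$ where $c_{nt}(x)=p_{nlt}x+q_{nlt}$ if $x\in[a_{nl},a_{n(l+1)})$. Cumulative cost: with discount factor $0<\gamma\le1$ and $K_t=\mathcal K_t(\xi_{[t]})$, $$Q(\mathcal K_{[T]},\xi)=c_0(K_0)+\sum_{t=1}^T\gamma^t\big(c_t(K_t-K_{t-1})-\Pi_t(K_{t-1},\xi_t)\big).$$ $[x]_+=\max\{x,0\}$. ''max'' in the definitions of $\mathrm{ENPV}_{\mathrm{flex}}$ and $\mathrm{ENPV}_\alpha(\beta)$ denotes the optimal value of the problem (the supremum, if a maximizer does not exist). *)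

(* Defs.v *)
(* MathComp / MathComp-Analysis development. *)
From HB Require Import structures.
From mathcomp Require Import all_boot all_order all_algebra.
From mathcomp Require Import all_classical all_reals all_analysis.

Set Implicit Arguments.
Unset Strict Implicit.
Unset Printing Implicit Defensive.

Import Order.TTheory GRing.Theory Num.Theory.

Local Open Scope classical_set_scope.
Local Open Scope ring_scope.

(* Measurability with respect to the trace sigma-algebra on [D]. Unlike
   [measurable_fun D f], which is void when [D] is not measurable, this makes
   sense for an arbitrary [D]; the two notions agree for measurable [D], see
   [trace_measurable_funE]. *)
Definition trace_measurable_fun d d' (T : measurableType d)
    (U : measurableType d') (D : set T) (f : T -> U) : Prop :=
  forall Y, measurable Y ->
    exists2 B, measurable B & D `&` f @^-1` Y = D `&` B.

Lemma trace_measurable_funE d d' (T : measurableType d)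
    (U : measurableType d') (D : set T) (f : T -> U) :
  measurable D -> trace_measurable_fun D f <-> measurable_fun D f.
Proof.
move=> mD; split=> [mf _ Y mY|mf Y mY].
  by have [B mB ->] := mf Y mY; exact: measurableI.
exists (D `&` f @^-1` Y); first exact: mf.
by rewrite setIA setIid.
Qed.

(* Periods, and the left endpoints of the line segments, are indexed by [nat]:
   the values of the time-indexed data beyond the horizon [T] are irrelevant.
   Facilities, customers and line segments are numbered from 0. *)
Section CapacityExpansion.
Context {R : realType} {nfac ncust : nat}.

Definition demand := ncust.-tuple R.

Definition capacity := nfac.-tuple nat.

Definition capacity_le (K K' : capacity) : Prop :=
  forall n, (tnth K n <= tnth K' n)%N.

Definition capacity_levels (Kmax : 'I_nfac -> R) : set capacity :=
  [set K | forall n, (tnth K n)%:R <= Kmax n].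

Definition history (x : nat -> demand) (t : nat) : t.+1.-tuple demand :=
  [tuple x s | s < t.+1].

Definition histories (Xi : nat -> set demand) (t : nat) :
    set (t.+1.-tuple demand) :=
  [set h | forall s : 'I_t.+1, Xi s (tnth h s)].

(* The value of a policy at time [t] is a function of the history up to [t];
   only its restriction to [histories Xi t] is ever constrained or used. *)
Definition policy := forall t : nat, t.+1.-tuple demand -> capacity.

Definition is_policy (T : nat) (Xi : nat -> set demand) (Kmax : 'I_nfac -> R)
    (K : policy) : Prop :=
  forall t, (t <= T)%N ->
    (forall h, histories Xi h -> capacity_levels Kmax (K t h)) /\
    trace_measurable_fun (@histories Xi t) (K t).

Definition feasible (T : nat) (Xi : nat -> set demand) (Kmax : 'I_nfac -> R) :
    set policy :=
  [set K | is_policy T Xi Kmax K /\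
    forall x : nat -> demand, (forall s, (s <= T)%N -> Xi s (x s)) ->
    forall t, (1 <= t <= T)%N ->
      capacity_le (K t.-1 (history x t.-1)) (K t (history x t))].

Definition allocations (K : capacity) (x : demand) : set 'M[R]_(ncust, nfac) :=
  [set z | [/\ forall i n, 0 <= z i n,
               forall i, \sum_n z i n <= tnth x i &
               forall n, \sum_i z i n <= (tnth K n)%:R]].

(* The maximum is attained for nonnegative demand [x]: [allocations K x] is then
   nonempty and compact. *)
Definition profit (r : 'I_ncust -> 'I_nfac -> nat -> R)
    (b : 'I_ncust -> nat -> R) (t : nat) (K : capacity) (x : demand) : R :=
  sup [set \sum_i \sum_n r i n t * z i n
           - \sum_i b i t * (tnth x i - \sum_n z i n)
      | z in allocations K x].

(* The intervals [a n l, a n l.+1) are disjoint, so at most one term of the sum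
   over [l] is present; [a n l] is the breakpoint number l + 1. *)
Definition facility_cost (L : nat) (a : 'I_nfac -> nat -> R)
    (p q : 'I_nfac -> 'I_L -> nat -> R) (n : 'I_nfac) (t : nat) (y : R) : R :=
  \sum_(l < L | a n l <= y < a n l.+1) (p n l t * y + q n l t).

Definition expansion_cost (L : nat) (a : 'I_nfac -> nat -> R)
    (p q : 'I_nfac -> 'I_L -> nat -> R) (t : nat) (dK : 'I_nfac -> R) : R :=
  \sum_n facility_cost a p q n t (dK n).

Definition cumulative_cost (T : nat)
    (r : 'I_ncust -> 'I_nfac -> nat -> R) (b : 'I_ncust -> nat -> R)
    (L : nat) (a : 'I_nfac -> nat -> R) (p q : 'I_nfac -> 'I_L -> nat -> R)
    (gamma : R) (K : policy) (x : nat -> demand) : R :=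
  let k t := K t (history x t) in
  expansion_cost a p q 0 (fun n => (tnth (k 0) n)%:R) +
  \sum_(1 <= t < T.+1) gamma ^+ t *
    (expansion_cost a p q t
       (fun n => (tnth (k t) n)%:R - (tnth (k t.-1) n)%:R)
     - profit r b t (k t.-1) (x t)).

Section Values.
Context {d : measure_display} {Omega : measurableType d}.
Variables (P : probability Omega R) (T : nat).
Variables (Xi : nat -> set demand) (xi : nat -> Omega -> demand).
Variables (Kmax : 'I_nfac -> R).
Variables (r : 'I_ncust -> 'I_nfac -> nat -> R) (b : 'I_ncust -> nat -> R).
Variables (L : nat) (a : 'I_nfac -> nat -> R).
Variables (p q : 'I_nfac -> 'I_L -> nat -> R) (gamma : R).

Let Q (K : policy) (w : Omega) : R :=
  cumulative_cost T r b a p q gamma K (fun t => xi t w).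

Definition ENPV_flex : \bar R :=
  ereal_sup [set 'E_P[fun w => (- Q K w)%R]%E | K in feasible T Xi Kmax].

Definition ENPV (alpha beta : R) : \bar R :=
  ereal_sup
    [set ((- ((1 - beta) * u))%:E
          - 'E_P[fun w => (beta * Q K w
                 + (1 - beta) / (1 - alpha) * Num.max (Q K w - u) 0)%R])%E
    | u in [set: R] & K in feasible T Xi Kmax].

End Values.

End CapacityExpansion.

(* Main.v *)
(* For a fixed policy and a fixed [u], the objective is
   [- E[(1 - beta) u + beta Q + (1 - beta) / (1 - alpha) (Q - u)^+]], whose
   integrand is pointwise nonincreasing in [beta] and equals [Q] at [beta = 1].
   Splitting off the constant [(1 - beta) u] requires [Q] to be integrable: the
   expansion costs are bounded, the profit is dominated by a linear function of
   the demand, and it is measurable since the supremum can be taken over the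
   countably many rational allocations. *)
Require Import Defs.
From HB Require Import structures.
From mathcomp Require Import all_boot all_order all_algebra.
From mathcomp Require Import all_classical all_reals all_analysis.
From mathcomp Require Import measurable_realfun lra.

Set Implicit Arguments.
Unset Strict Implicit.

Import Order.TTheory GRing.Theory Num.Theory.

Local Open Scope classical_set_scope.
Local Open Scope ring_scope.

(** * Measurability and integrability of real-valued functions *)

Lemma measurable_set_forall {d} {T : measurableType d} {I : finType}
    (F : I -> set T) :
  (forall i, measurable (F i)) -> measurable [set w | forall i, F i w].
Proof.
move=> mF; rewrite (_ : [set _ | _] = \bigcap_(i in [set: I]) F i).
  by apply: fin_bigcap_measurable => // i _; exact: mF.
by apply/seteqP; split=> w /= Fw i //; exact: Fw.
Qed.

Lemma measurable_set_ler {d} {T : measurableType d} {R : realType}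
    (f g : T -> R) :
  measurable_fun [set: T] f -> measurable_fun [set: T] g ->
  measurable [set w | f w <= g w].
Proof.
move=> mf mg; rewrite -[X in measurable X]setTI.
exact: (measurable_fun_ler mf mg measurableT (I : measurable [set true])).
Qed.

Lemma measurable_set_ltr {d} {T : measurableType d} {R : realType}
    (f g : T -> R) :
  measurable_fun [set: T] f -> measurable_fun [set: T] g ->
  measurable [set w | f w < g w].
Proof.
move=> mf mg; rewrite -[X in measurable X]setTI.
exact: (measurable_fun_ltr mf mg measurableT (I : measurable [set true])).
Qed.

Lemma measurable_fun_gt {d} {T : measurableType d} {R : realType}
    (f : T -> R) :
  (forall c, measurable [set w | c < f w]) -> measurable_fun [set: T] f.
Proof.
move=> mf; apply: (measurability _ (RGenOInfty.measurableE R)).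
move=> _ [_ [c ->] <-]; rewrite setTI.
rewrite (_ : _ @^-1` _ = [set w | c < f w]); first exact: mf.
by apply/seteqP; split=> w /=; rewrite in_itv/= andbT.
Qed.

Lemma measurable_fun_natr {d} {T : measurableType d} {R : realType}
    (f : T -> nat) :
  measurable_fun [set: T] f -> measurable_fun [set: T] (fun w => (f w)%:R : R).
Proof.
(* Every subset of [nat] is measurable, in particular the one whose image under [%:R] lies in
   [Y]. *)
by move=> mf _ Y mY; exact: (mf measurableT ((fun m : nat => m%:R) @^-1` Y)).
Qed.

Lemma measurable_trace_comp {d d' d''} {W : measurableType d}
    {T : measurableType d'} {U : measurableType d''} {D : set T}
    {f : T -> U} {h : W -> T} :
  trace_measurable_fun D f -> measurable_fun [set: W] h ->
  (forall w, D (h w)) -> measurable_fun [set: W] (f \o h).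
Proof.
move=> mf mh Dh _ Y mY; have [B mB DfB] := mf Y mY.
rewrite setTI (_ : _ @^-1` _ = h @^-1` B).
  by rewrite -[X in measurable X]setTI; exact: mh.
apply/seteqP; split=> w /= hw.
  have : (D `&` f @^-1` Y) (h w) by split; [exact: Dh|].
  by rewrite DfB => -[].
have : (D `&` B) (h w) by split; [exact: Dh|].
by rewrite -DfB => -[].
Qed.

Lemma integrable_le_real {d} {T : measurableType d} {R : realType}
    {mu : {measure set T -> \bar R}} (f g : T -> R) :
  measurable_fun [set: T] f -> (forall w, `|f w| <= g w) ->
  mu.-integrable [set: T] (EFin \o g) -> mu.-integrable [set: T] (EFin \o f).
Proof.
move=> mf fg; apply: le_integrable => //; first exact/measurable_EFinP.
by move=> w _ /=; rewrite lee_fin (le_trans (fg w))// ler_norm.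
Qed.

Lemma integrableD_real {d} {T : measurableType d} {R : realType}
    {mu : {measure set T -> \bar R}} (f g : T -> R) :
  mu.-integrable [set: T] (EFin \o f) -> mu.-integrable [set: T] (EFin \o g) ->
  mu.-integrable [set: T] (EFin \o fun w => f w + g w).
Proof. exact: integrableD. Qed.

Lemma integrableB_real {d} {T : measurableType d} {R : realType}
    {mu : {measure set T -> \bar R}} (f g : T -> R) :
  mu.-integrable [set: T] (EFin \o f) -> mu.-integrable [set: T] (EFin \o g) ->
  mu.-integrable [set: T] (EFin \o fun w => f w - g w).
Proof. exact: integrableB. Qed.

Lemma integrableZ_real {d} {T : measurableType d} {R : realType}
    {mu : {measure set T -> \bar R}} (c : R) (f : T -> R) :
  mu.-integrable [set: T] (EFin \o f) ->
  mu.-integrable [set: T] (EFin \o fun w => c * f w).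
Proof. exact: integrableZl. Qed.

Lemma integrable_sum_real {d} {T : measurableType d} {R : realType}
    {mu : {measure set T -> \bar R}} {I : Type} (s : seq I) (Q : pred I)
    (f : I -> T -> R) :
  (forall i, Q i -> mu.-integrable [set: T] (EFin \o f i)) ->
  mu.-integrable [set: T] (EFin \o fun w => \sum_(i <- s | Q i) f i w).
Proof.
move=> fi; rewrite (_ : _ \o _ = fun w => (\sum_(i <- s | Q i) (f i w)%:E)%E).
  exact: integrable_sum.
by apply/funext => w /=; rewrite sumEFin.
Qed.

(** * Linear bound and measurability of the one-period profit *)

Section Profit.
Context {R : realType} {nfac ncust : nat}.
Implicit Types (K : @capacity nfac) (x : @demand R ncust).
Implicit Types (z : 'M[R]_(ncust, nfac)).
Variables (r : 'I_ncust -> 'I_nfac -> nat -> R) (b : 'I_ncust -> nat -> R).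
Variable t : nat.

Definition allocation_profit x z : R :=
  \sum_i \sum_n r i n t * z i n - \sum_i b i t * (tnth x i - \sum_n z i n).

(** Isolates the part linear in [z]; the remainder depends on the demand only and cancels when two
    allocations are compared. *)
Lemma allocation_profitE x z :
  allocation_profit x z =
  \sum_i \sum_n (r i n t + b i t) * z i n - \sum_i b i t * tnth x i.
Proof.
rewrite /allocation_profit -!sumrB; apply: eq_bigr => i _.
under [in RHS]eq_bigr do rewrite mulrDl.
by rewrite big_split /= -mulr_sumr mulrBr opprB addrA.
Qed.

(** Nonnegativity of [z] and the demand constraint put each [z i n], and also the unmet demand of
    customer [i], between 0 and [tnth x i]. *)
Lemma allocation_profit_bound K x z : allocations K x z ->
  `|allocation_profit x z| <=
  \sum_i (\sum_n `|r i n t| + `|b i t|) * tnth x i.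
Proof.
move=> [z0 zx _].
have zinx i n : z i n <= tnth x i.
  apply: le_trans (zx i); rewrite (bigD1 n)//= lerDl.
  by apply: sumr_ge0 => k _; exact: z0.
rewrite /allocation_profit -sumrB (le_trans (ler_norm_sum _ _ _))//.
apply: ler_sum => i _; rewrite (le_trans (ler_normB _ _))// mulrDl.
rewrite mulr_suml lerD//.
  rewrite (le_trans (ler_norm_sum _ _ _))//; apply: ler_sum => n _.
  by rewrite normrM ler_wpM2l// ger0_norm.
rewrite normrM ler_wpM2l// ger0_norm ?subr_ge0// gerBl.
by apply: sumr_ge0 => n _.
Qed.

Lemma allocations0 K x : (forall i, 0 <= tnth x i) -> allocations K x 0.
Proof.
move=> x0; split=> [i n|i|n]; first by rewrite mxE.
  by rewrite big1// => n _; rewrite mxE.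
by rewrite big1// => i _; rewrite mxE.
Qed.

Lemma profit_bound K x : (forall i, 0 <= tnth x i) ->
  `|profit r b t K x| <= \sum_i (\sum_n `|r i n t| + `|b i t|) * tnth x i.
Proof.
move=> x0; set M := (X in _ <= X).
have zM z : allocations K x z -> - M <= allocation_profit x z <= M.
  by move=> /allocation_profit_bound; rewrite ler_norml.
(* The zero allocation makes the set nonempty, so its [sup] is not the default value, and bounds
   that [sup] from below by [- M]. *)
have S0 : (allocation_profit x @` allocations K x) (allocation_profit x 0).
  by exists 0 => //; exact: allocations0.
have SM : ubound (allocation_profit x @` allocations K x) M.
  by move=> _ [z /zM /andP[_ ?] <-].
rewrite ler_norml; apply/andP; split; last first.
  by apply: ge_sup SM; exists (allocation_profit x 0).
have /zM/andP[+ _] := allocations0 K x0.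
by move=> /le_trans; apply; apply: (@ub_le_sup _ _ _ _ S0); exists M.
Qed.

Lemma rat_approx_below (y e : R) : 0 <= y -> 0 < e ->
  exists q : rat, 0 <= (ratr q : R) <= y /\ y - ratr q <= e.
Proof.
rewrite le_eqVlt => /predU1P[<-|y0] e0.
  (* For [y = 0] the open interval used below is empty, and 0 itself serves. *)
  by exists 0; rewrite !rmorph0 lexx subr0 (ltW e0).
have /rat_in_itvoo[q] : Num.max 0 (y - e) < y by rewrite gt_max y0 gtrBl.
rewrite in_itv/= gt_max => /andP[/andP[q0 qe] qy]; exists q.
by rewrite (ltW q0) (ltW qy); split=> //; lra.
Qed.

(* The feasible set is closed under decreasing the entries of [z], so any
   allocation is approximated by rational ones from below. *)
Lemma rat_allocation_dense K x z c : allocations K x z ->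
  c < allocation_profit x z ->
  exists2 y : 'M[rat]_(ncust, nfac),
    allocations K x (map_mx ratr y) & c < allocation_profit x (map_mx ratr y).
Proof.
move=> [z0 zx zK] cz.
set C := \sum_i \sum_n `|r i n t + b i t|.
have C0 : 0 <= C by do 2 (apply: sumr_ge0 => ? _).
(* Lowering every entry by at most [e] costs at most [C * e], which is less than the slack
   [allocation_profit x z - c]; the [+ 1] keeps the divisor positive when [C = 0]. *)
set e := (allocation_profit x z - c) / (C + 1).
have e0 : 0 < e by rewrite divr_gt0 ?subr_gt0// ltr_wpDl.
have [f fP] := choice (fun ij : 'I_ncust * 'I_nfac =>
  rat_approx_below (z0 ij.1 ij.2) e0).
exists (\matrix_(i, n) f (i, n)).
  split=> [i n|i|n].
  - by rewrite !mxE; have [/andP[]] := fP (i, n).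
  - apply: le_trans (zx i); apply: ler_sum => n _.
    by rewrite !mxE; have [/andP[]] := fP (i, n).
  - apply: le_trans (zK n); apply: ler_sum => i _.
    by rewrite !mxE; have [/andP[]] := fP (i, n).
suff : allocation_profit x z -
    allocation_profit x (map_mx ratr (\matrix_(i, n) f (i, n))) <= C * e.
  move=> le; have : C * e < allocation_profit x z - c.
    rewrite -[ltRHS](divfK (_ : C + 1 != 0)) -/e; last first.
      by rewrite gt_eqF// ltr_wpDl.
    by rewrite mulrDr mulr1 mulrC ltrDl.
  lra.
rewrite !allocation_profitE opprB addrA subrK -sumrB /C mulr_suml.
apply: ler_sum => i _; rewrite -sumrB mulr_suml; apply: ler_sum => n _.
have [/andP[_ fz] fe] := fP (i, n).
rewrite -mulrBr !mxE (le_trans (ler_norm _))// normrM ler_wpM2l//.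
by rewrite ger0_norm// subr_ge0.
Qed.

(** Rational matrices are countable, so this writes the strict superlevel sets of the profit as
    countable unions. The strict inequality leaves room for the rational approximation. *)
Lemma profit_gtP K x c : (forall i, 0 <= tnth x i) ->
  c < profit r b t K x <-> exists2 y : 'M[rat]_(ncust, nfac),
    allocations K x (map_mx ratr y) & c < allocation_profit x (map_mx ratr y).
Proof.
move=> x0; split=> [|[y Ky cy]].
  move=> /sup_gt[|_ [z Kz <-] cz]; last exact: rat_allocation_dense cz.
  by exists (allocation_profit x 0), 0 => //; exact: allocations0.
apply: lt_le_trans cy _; apply: ub_le_sup; last by exists (map_mx ratr y).
exists (\sum_i (\sum_n `|r i n t| + `|b i t|) * tnth x i) => _ [z Kz <-].
exact: le_trans (ler_norm _) (allocation_profit_bound Kz).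
Qed.

Lemma measurable_profit {d} {W : measurableType d}
    (k : W -> @capacity nfac) (x : W -> @demand R ncust) :
  measurable_fun [set: W] k -> measurable_fun [set: W] x ->
  (forall w i, 0 <= tnth (x w) i) ->
  measurable_fun [set: W] (fun w => profit r b t (k w) (x w)).
Proof.
move=> mk mx x0; apply: measurable_fun_gt => c.
have mxi i : measurable_fun [set: W] (fun w => tnth (x w) i).
  exact: (measurable_fun_tnthP x).1 mx i.
have mkn n : measurable_fun [set: W] (fun w => (tnth (k w) n)%:R : R).
  exact: measurable_fun_natr ((measurable_fun_tnthP k).1 mk n).
pose F (y : 'M[rat]_(ncust, nfac)) := [set w |
  allocations (k w) (x w) (map_mx ratr y)
  /\ c < allocation_profit (x w) (map_mx ratr y)].
rewrite (_ : [set w | _] = \bigcup_y F y); last first.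
  apply/seteqP; split=> w /= => [/(profit_gtP _ _ (x0 w))[y yk cy]|[y _ [yk cy]]].
    by exists y.
  by apply/(profit_gtP _ _ (x0 w)); exists y.
apply: countable_bigcupT_measurable => [|y]; first exact: countableP.
pose z : 'M[R]_(ncust, nfac) := map_mx ratr y.
(* For fixed [y], finitely many inequalities between measurable functions of [w] remain. *)
rewrite (_ : F y = [set w | forall i, forall n, 0 <= z i n]
    `&` [set w | forall i, \sum_n z i n <= tnth (x w) i]
    `&` [set w | forall n, \sum_i z i n <= (tnth (k w) n)%:R]
    `&` [set w | c < allocation_profit (x w) z]); last first.
  by apply/seteqP; split=> w [] => [[? ? ?]|[[? ?] ?]].
apply: measurableI; [apply: measurableI; [apply: measurableI|]|].
- by do 2 (apply: measurable_set_forall => ?); exact: measurable_set_ler.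
- by apply: measurable_set_forall => i; exact: measurable_set_ler.
- by apply: measurable_set_forall => n; exact: measurable_set_ler.
- apply: measurable_set_ltr => //; apply: measurable_funB => //.
  apply: measurable_sum => i; apply: measurable_funM => //.
  exact: measurable_funB.
Qed.

End Profit.

(** * Boundedness and integrability of the expansion cost *)

Section ExpansionCost.
Context {R : realType} {nfac L : nat}.
Variables (a : 'I_nfac -> nat -> R) (p q : 'I_nfac -> 'I_L -> nat -> R).

Lemma measurable_facility_cost n t :
  measurable_fun [set: R] (facility_cost a p q n t).
Proof.
rewrite /facility_cost; under eq_fun do rewrite big_mkcond.
apply: measurable_sum => l; apply: measurable_fun_ifT => //.
  by apply: measurable_and; [exact: measurable_fun_ler|exact: measurable_fun_ltr].
by apply: measurable_funD => //; exact: measurable_funM.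
Qed.

(** A summand is present only when [y] lies in its segment, where [|y|] is at most the sum of the
    moduli of the endpoints. The bound is free of [y], hence integrable under a probability. *)
Lemma facility_cost_bound n t (y : R) :
  `|facility_cost a p q n t y| <=
  \sum_(l < L) (`|p n l t| * (`|a n l| + `|a n l.+1|) + `|q n l t|).
Proof.
rewrite /facility_cost big_mkcond (le_trans (ler_norm_sum _ _ _))//.
apply: ler_sum => l _; case: ifPn => [/andP[ay ya]|_]; last first.
  by rewrite normr0 addr_ge0// mulr_ge0// addr_ge0.
rewrite (le_trans (ler_normD _ _))// lerD2r normrM ler_wpM2l//.
rewrite ler_norml; have := ler_norm (- a n l); have := ler_norm (a n l.+1).
rewrite normrN; have := normr_ge0 (a n l); have := normr_ge0 (a n l.+1).
by move=> *; apply/andP; split; lra.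
Qed.

Lemma integrable_expansion_cost {d} {W : measurableType d}
    {P : probability W R} t (y : W -> 'I_nfac -> R) :
  (forall n, measurable_fun [set: W] (fun w => y w n)) ->
  P.-integrable [set: W] (EFin \o fun w => expansion_cost a p q t (y w)).
Proof.
move=> my; apply: integrable_sum_real => n _.
apply: integrable_le_real (finite_measure_integrable_cst _ _ measurableT).
  exact: (measurableT_comp (measurable_facility_cost n t) (my n)).
by move=> w; exact: facility_cost_bound.
Qed.

End ExpansionCost.

(** * Monotonicity in [beta] of the mean-CVaR objective of an integrable cost *)

Section MeanCVaR.
Context {d} {W : measurableType d} {R : realType} (P : probability W R).
Variable X : W -> R.
Hypothesis iX : P.-integrable [set: W] (EFin \o X).

(** The integrand of [ENPV] at cost [x]; the term [(1 - beta) * u] stays outside the expectation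
    there. *)
Definition mean_cvar (alpha u beta x : R) : R :=
  beta * x + (1 - beta) / (1 - alpha) * Num.max (x - u) 0.

Lemma integrable_mean_cvar alpha u beta :
  P.-integrable [set: W] (EFin \o (mean_cvar alpha u beta \o X)).
Proof.
have mX : measurable_fun [set: W] X.
  by apply/measurable_EFinP; exact: measurable_int iX.
have imax : P.-integrable [set: W] (EFin \o fun w => Num.max (X w - u) 0).
  apply: (@integrable_le_real _ _ _ _ _ (fun w => `|X w| + `|u|)).
  - by apply: measurable_maxr => //; exact: measurable_funB.
  - move=> w; rewrite ger0_norm ?le_max ?lexx ?orbT// ge_max addr_ge0// andbT.
    by rewrite lerD ?ler_norm// -normrN ler_norm.
  - apply: integrableD_real (integrable_norm iX) _.
    exact: (finite_measure_integrable_cst P `|u| measurableT).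
by apply: integrableD_real; exact: integrableZ_real.
Qed.

(* [u + (x - u)^+ / (1 - alpha) >= x] since [1 - alpha] lies in [(0, 1]], and
   the sides below are [x + (1 - beta) * (u + (x - u)^+ / (1 - alpha) - x)]. *)
Lemma mean_cvar_nonincreasing (alpha u beta1 beta2 x : R) :
  0 <= alpha < 1 -> beta1 <= beta2 ->
  (1 - beta2) * u + mean_cvar alpha u beta2 x <=
  (1 - beta1) * u + mean_cvar alpha u beta1 x.
Proof.
move=> /andP[a0 a1] b12; rewrite /mean_cvar -!mulrA.
set m := Num.max _ _.
have m0 : 0 <= m by rewrite le_max lexx orbT.
have mx : x - u <= m by rewrite le_max lexx.
have : m <= (1 - alpha)^-1 * m.
  by rewrite ler_peMl// invf_ge1 ?subr_gt0// gerBl.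
set v := _^-1 * m => mv.
(* This product is the right side minus the left side. *)
have : 0 <= (beta2 - beta1) * (u + v - x) by rewrite mulr_ge0//; lra.
by nra.
Qed.

Lemma mean_cvar_value_nondecreasing (alpha u beta1 beta2 : R) :
  0 <= alpha < 1 -> beta1 <= beta2 ->
  ((- ((1 - beta1) * u))%:E - 'E_P[mean_cvar alpha u beta1 \o X] <=
   (- ((1 - beta2) * u))%:E - 'E_P[mean_cvar alpha u beta2 \o X])%E.
Proof.
move=> alpha01 b12.
(* The constant moves under the expectation, so that the pointwise comparison can be integrated. *)
have valueE beta : ((- ((1 - beta) * u))%:E - 'E_P[mean_cvar alpha u beta \o X]
    = - 'E_P[fun w => ((1 - beta) * u + mean_cvar alpha u beta (X w))%R])%E.
  have -> : (fun w => (1 - beta) * u + mean_cvar alpha u beta (X w)) =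
      cst ((1 - beta) * u) \+ (mean_cvar alpha u beta \o X) by [].
  rewrite [in RHS]expectationD ?expectation_cst; last 2 first.
  - apply/Lfun1_integrable.
    exact: (finite_measure_integrable_cst P ((1 - beta) * u) measurableT).
  - by apply/Lfun1_integrable; exact: integrable_mean_cvar.
  by rewrite [in RHS]addeC fin_num_oppeD// addeC.
rewrite !valueE leeN2 unlock; apply: le_integral => //=.
- apply: integrableD_real (integrable_mean_cvar alpha u beta2).
  exact: (finite_measure_integrable_cst P ((1 - beta2) * u) measurableT).
- apply: integrableD_real (integrable_mean_cvar alpha u beta1).
  exact: (finite_measure_integrable_cst P ((1 - beta1) * u) measurableT).
- by move=> w _; rewrite lee_fin; exact: mean_cvar_nonincreasing.
Qed.

(** The endpoint [beta = 1] of the monotone family is the risk-neutral objective, which reduces part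
    (ii) to comparing [beta] with 1. *)
Lemma mean_cvar_value1 (alpha u : R) :
  ((- ((1 - 1) * u))%:E - 'E_P[mean_cvar alpha u 1 \o X]
   = 'E_P[fun w => (- X w)%R])%E.
Proof.
rewrite subrr mul0r oppr0 add0e.
have -> : mean_cvar alpha u 1 \o X = X.
  by apply/funext => w; rewrite /= /mean_cvar subrr mul1r !mul0r addr0.
have -> : (fun w => - X w) = -1 \o* X.
  by apply/funext => w /=; rewrite mulrN1.
by rewrite expectationZl ?EFinN ?mulN1e//; exact/Lfun1_integrable.
Qed.

End MeanCVaR.

(** * Integrability of the cumulative cost of a policy *)

Section CumulativeCost.
Context {R : realType} {nfac ncust : nat}.
Context {d} {W : measurableType d} {P : probability W R}.
Variables (T : nat) (Kmax : 'I_nfac -> R) (Xi : nat -> set (@demand R ncust)).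
Variable xi : nat -> W -> @demand R ncust.
Hypothesis Xi_ge0 : forall t, (t <= T)%N ->
  forall x, Xi t x -> forall i, 0 <= tnth x i.
Hypothesis xi_meas : forall t, (t <= T)%N -> measurable_fun [set: W] (xi t).
Hypothesis xi_in : forall t, (t <= T)%N -> forall w, Xi t (xi t w).
Hypothesis xi_int : forall t, (t <= T)%N -> forall i,
  P.-integrable [set: W] (fun w => (tnth (xi t w) i)%:E).
Variable K : @policy R nfac ncust.
Arguments K : clear implicits.
Hypothesis KP : is_policy T Xi Kmax K.

Let sample w t := xi t w.

(** A policy is measurable only for the trace on [histories Xi t]; by [xi_in] every observed history
    belongs to that set. *)
Lemma measurable_policy_path t : (t <= T)%N ->
  measurable_fun [set: W] (fun w => K t (history (sample w) t)).
Proof.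
move=> tT; apply: (measurable_trace_comp (KP tT).2) => [|w s].
  apply/measurable_fun_tnthP => s.
  rewrite (_ : _ \o _ = xi s); last by apply/funext => w /=; rewrite tnth_mktuple.
  by apply: xi_meas; rewrite (leq_trans _ tT)// -ltnS.
rewrite tnth_mktuple; apply: xi_in.
by rewrite (leq_trans _ tT)// -ltnS.
Qed.

Lemma measurable_policy_capacity t n : (t <= T)%N ->
  measurable_fun [set: W] (fun w => (tnth (K t (history (sample w) t)) n)%:R : R).
Proof.
move=> tT; apply: measurable_fun_natr.
exact: (measurable_fun_tnthP _).1 (measurable_policy_path tT) n.
Qed.

Variables (r : 'I_ncust -> 'I_nfac -> nat -> R) (b : 'I_ncust -> nat -> R).
Variables (L : nat) (a : 'I_nfac -> nat -> R).
Variables (p q : 'I_nfac -> 'I_L -> nat -> R) (gamma : R).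

Lemma integrable_policy_profit t : (t < T)%N ->
  P.-integrable [set: W] (EFin \o fun w =>
    profit r b t.+1 (K t (history (sample w) t)) (xi t.+1 w)).
Proof.
move=> tT; have x0 w i : 0 <= tnth (xi t.+1 w) i.
  by apply: Xi_ge0 (xi_in tT w) i.
apply: integrable_le_real (fun w => profit_bound r b t.+1 _ (x0 w)) _.
  by apply: measurable_profit => //; [exact: measurable_policy_path (ltnW tT)
                                    |exact: xi_meas].
apply: integrable_sum_real => i _.
exact: integrableZ_real (xi_int tT i).
Qed.

Lemma integrable_cumulative_cost :
  P.-integrable [set: W]
    (EFin \o fun w => cumulative_cost T r b a p q gamma K (sample w)).
Proof.
rewrite /cumulative_cost; apply: integrableD_real.
  by apply: integrable_expansion_cost => n; exact: measurable_policy_capacity.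
(* Periods become [t.+1] with [t < T], so the preceding capacity is the one at [t], as in
   [integrable_policy_profit]. *)
under [X in EFin \o X]eq_fun do rewrite big_add1 big_nat_cond.
apply: integrable_sum_real => t /andP[/andP[_ tT] _].
apply: integrableZ_real; apply: integrableB_real.
  apply: integrable_expansion_cost => n.
  apply: measurable_funB; apply: measurable_policy_capacity => //.
  exact: ltnW.
exact: integrable_policy_profit tT.
Qed.

End CumulativeCost.

Theorem proposition1 (R : realType) (nfac ncust T L : nat)
  (d : measure_display) (Omega : measurableType d) (P : probability Omega R)
  (Kmax : 'I_nfac -> R)
  (Xi : nat -> set (ncust.-tuple R))
  (Xi_ge0 : forall t, (t <= T)%N ->
     forall x, Xi t x -> forall i, 0 <= tnth x i)
  (xi : nat -> Omega -> ncust.-tuple R)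
  (xi_meas : forall t, (t <= T)%N -> measurable_fun [set: Omega] (xi t))
  (xi_in : forall t, (t <= T)%N -> forall w, Xi t (xi t w))
  (xi_int : forall t, (t <= T)%N -> forall i,
     P.-integrable [set: Omega] (fun w => (tnth (xi t w) i)%:E))
  (xi0_known : exists x0, forall w, xi 0%N w = x0)
  (r : 'I_ncust -> 'I_nfac -> nat -> R) (b : 'I_ncust -> nat -> R)
  (a : 'I_nfac -> nat -> R)
  (a_start : forall n, a n 0%N = 0)
  (a_incr : forall n l, (l < L)%N -> a n l < a n l.+1)
  (a_end : forall n, Kmax n < a n L)
  (p q : 'I_nfac -> 'I_L -> nat -> R)
  (gamma : R) (gamma_gt0 : 0 < gamma) (gamma_le1 : gamma <= 1) :
  (forall alpha : R, 0 < alpha < 1 ->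
     forall beta1 beta2 : R, 0 <= beta1 -> beta1 <= beta2 -> beta2 <= 1 ->
       (ENPV P T Xi xi Kmax r b a p q gamma alpha beta1
        <= ENPV P T Xi xi Kmax r b a p q gamma alpha beta2)%E)
  /\
  (forall alpha beta : R, 0 < alpha < 1 -> 0 <= beta <= 1 ->
     (ENPV P T Xi xi Kmax r b a p q gamma alpha beta
      <= ENPV_flex P T Xi xi Kmax r b a p q gamma)%E).
Proof.
have iQ K : feasible T Xi Kmax K -> P.-integrable [set: Omega]
    (EFin \o fun w => cumulative_cost T r b a p q gamma K (xi^~ w)).
  by move=> [KP _]; exact: (integrable_cumulative_cost Xi_ge0 xi_meas xi_in xi_int KP).
split=> [alpha alpha01 beta1 beta2 _ b12 _|alpha beta alpha01 /andP[_ b1]].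
  apply: ge_ereal_sup => _ [u _ [K fK <-]].
  have alpha01' : 0 <= alpha < 1 by case/andP: alpha01 => /ltW-> ->.
  apply: le_trans (mean_cvar_value_nondecreasing (iQ K fK) u alpha01' b12) _.
  (* The feasible set does not depend on [beta], so the same [u] and [K] compete at [beta2]. *)
  by apply: ereal_sup_ubound; exists u => //; exists K.
apply: ge_ereal_sup => _ [u _ [K fK <-]].
have alpha01' : 0 <= alpha < 1 by case/andP: alpha01 => /ltW-> ->.
apply: le_trans (mean_cvar_value_nondecreasing (iQ K fK) u alpha01' b1) _.
(* At [beta = 1] the value no longer involves [u], and [K] alone is the competitor in
   [ENPV_flex]. *)
by rewrite mean_cvar_value1; [apply: ereal_sup_ubound; exists K|exact: iQ].
Qed.
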